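(* Let $p>1$ be an integer and let $u^{(p)}$ be the fixed point of the substitution $\varphi_p(L)=L^pS$, $\varphi_p(S)=M$, $\varphi_p(M)=L^{p-1}S$. Let $v,w$ be factors of $u^{(p)}$ with $|v|=|w|$. Then $\left||v|_S-|w|_S\right|\le 2$.
   Context: $u^{(p)}=\lim_{n\to\infty}\varphi_p^n(L)$ is the unique infinite word over $\{L,S,M\}$ fixed by $\varphi_p$. A factor is a finite contiguous subword; $|w|$ is the length and $|w|_a$ the number of occurrences of the letter $a$ in $w$. *)

(* Defs.v *)
From HB Require Import structures.
From mathcomp Require Import all_boot.
Set Implicit Arguments. Unset Strict Implicit. Unset Printing Implicit Defensive.

Inductive letter := lL | lS | lM.
Definition letter_eqb (a b : letter) : bool :=
  match a, b with lL, lL | lS, lS | lM, lM => true | _, _ => false end.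
Lemma letter_eqP : Equality.axiom letter_eqb.
Proof. by case; case; constructor. Qed.
HB.instance Definition _ := hasDecEq.Build letter letter_eqP.

Definition phi_letter (p : nat) (a : letter) : seq letter :=
  match a with
  | lL => rcons (nseq p lL) lS
  | lS => [:: lM]
  | lM => rcons (nseq p.-1 lL) lS
  end.

Definition phi (p : nat) (w : seq letter) : seq letter :=
  flatten (map (phi_letter p) w).

Definition phi_iter (p n : nat) : seq letter := iter n (phi p) [:: lL].

(* The fixed point u^(p) = lim phi_p^n(L), as an infinite word nat -> letter.
   Since phi_p(L) begins with L, each phi_p^n(L) is a prefix of phi_p^(n+1)(L),
   and |phi_p^n(L)| >= n+1, so the i-th letter of u^(p) is the i-th letter
   of phi_p^(i+1)(L). *)
Definition u (p : nat) (i : nat) : letter := nth lL (phi_iter p i.+1) i.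

Definition factor_at (p i n : nat) : seq letter := mkseq (fun k => u p (i + k)) n.

Definition is_factor (p : nat) (v : seq letter) : Prop :=
  exists i, v = factor_at p i (size v).

Definition occ (a : letter) (v : seq letter) : nat := count_mem a v.

(* Main.v *)
(** Let e(j) be the length of the shortest prefix of u containing j letters
    other than S, N(j) its number of S, and B(j) its number of S minus its number
    of M.  Since u is the concatenation of the blocks phi(u_k), and every block
    except phi(S) = M ends with its only S, the prefix of length i has at least j
    letters S iff i >= |phi(prefix of length e(j))| = (p+1) j + B(j).  Hence the
    gaps between consecutive S are p+1 or p+2, and an excess of 3 letters S among
    factors of the same length forces an excess of at least p+3 in the increments
    of B over windows of the same length.

    That is impossible, because those increments differ by at most 3.  Indeed
    applying the same description to e(j) gives
    p N(j) + B(N(j)) < j <= p (N(j)+1) + B(N(j)+1)  and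
    B(j) = N(j) - N(N(j)+1),
    so the discrepancies of N over windows of length n are controlled by those of
    B over shorter windows and vice versa: a simultaneous induction on n gives the
    bound 3 for B and 2 for N.  The induction closes for p = 2 only with a
    sharper bound for N: a window at least 2 longer has at most 1 letter less. *)

Require Import Defs.
From mathcomp Require Import all_boot all_order all_algebra.
From mathcomp Require Import zify.

(** * Balance bounds from the counting recursion *)

Section CountingRecursion.

Variables N B : nat -> nat.
Hypothesis N_step : forall j, N j <= N j.+1 <= (N j).+1.
Hypothesis B_rec : forall j, B j + N (N j).+1 = N j.

Lemma N_range a n : N a <= N (a + n) <= N a + n.
Proof.
by elim: n => [|n IHn]; rewrite ?addn0 ?addnS; [|have := N_step (a + n)]; lia.
Qed.

(** Since [N] grows by at most 1 per step, [N (N j).+1] never grows faster than [N j]. *)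
Lemma B_mono a n : B a <= B (a + n).
Proof.
elim: n => [|n IHn]; first by rewrite addn0.
apply: leq_trans IHn _; rewrite addnS; move: (a + n) => {a n} j.
have /andP[Nj1 Nj2] := N_step j.
have := N_range (N j).+1 (N j.+1 - N j).
have -> : (N j).+1 + (N j.+1 - N j) = (N j.+1).+1 by lia.
by have := B_rec j; have := B_rec j.+1; lia.
Qed.

Variable p : nat.
Hypothesis p_gt1 : 1 < p.
Hypothesis N_lb : forall j, 0 < j -> p * N j + B (N j) < j.
Hypothesis N_ub : forall j, j <= p * (N j).+1 + B (N j).+1.

(** [c] is positive because [N_lb] cannot hold at 0; [a] may be 0, since it will be a value of
    [N]. *)
Definition B_balanced n := forall a c, 0 < c ->
  B (a + n) + B c <= B (c + n) + B a + 3.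
Definition N_balanced n := forall a c, 0 < c ->
  N (a + n) + N c <= N (c + n) + N a + 2 /\
  N (a + n) + N c <= N (c + n.+2) + N a + 1.

(* The second bound of [N_balanced] serves the case where two windows of equal
   length have increments of [N] differing by exactly 2: it brings the bound on
   [B] down from 4 to 3, without which the induction fails for [p = 2]. *)
Lemma N_balanced_step n : (forall m, m < n -> B_balanced m) -> N_balanced n.
Proof.
move=> balB a c c_gt0.
(* Failure of the first bound gives k = 3, r = 0, failure of the second k = r = 2; both are absurd
   for p > 1. *)
have key k r : 1 < k -> N (c + (n + r)) + N a + k <= N (a + n) + N c ->
    p * k + r + 2 <= 2 * p + 3.
  move=> k_gt1 hk.
  have ra := N_range a n; have rc := N_range c (n + r).
  set K := N (c + (n + r)) - N c in rc *.
  have hB : B_balanced K.+1 by apply: balB; lia.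
  have := hB (N c) (N a).+1 isT.
  have := B_mono ((N a).+1 + K.+1) (N (a + n) - N a - K.+2).
  have -> : (N a).+1 + K.+1 + (N (a + n) - N a - K.+2) = N (a + n) by lia.
  have -> : N c + K.+1 = (N (c + (n + r))).+1 by lia.
  have := N_lb c c_gt0; have := N_ub (c + (n + r)).
  have := N_ub a; have : 0 < a + n by lia.
  move/N_lb.
  have : p * N (a + n) = p * (N a + k + K + (N (a + n) - N a - k - K)).
    by congr (p * _); lia.
  have : p * (N (c + (n + r))).+1 = p * (N c + K).+1 by congr (p * _); lia.
  rewrite !mulnS !mulnDr.
  move: (p * k) (p * N a) (p * N c) (p * K) (p * (_ - _)) (p * N (a + n)).
  by lia.
split.
  by rewrite leqNgt; apply/negP=> h; have := key 3 0 isT; rewrite (addn0 n); lia.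
by rewrite leqNgt; apply/negP=> h; have := key 2 2 isT; rewrite (addn2 n); lia.
Qed.

Lemma B_balanced_step n : (forall m, m <= n -> N_balanced m) -> B_balanced n.
Proof.
move=> balN.
have pos a c : forall m, m <= n -> 0 < a -> 0 < c ->
    B (a + m) + B c <= B (c + m) + B a + 3.
  move=> m le_mn a_gt0 c_gt0.
  have [bac _] := balN _ le_mn a c c_gt0; have [bca _] := balN _ le_mn c a a_gt0.
  have ra := N_range a m; have rc := N_range c m.
  have := B_rec a; have := B_rec c; have := B_rec (a + m); have := B_rec (c + m).
  set n1 := N (a + m) - N a; set n2 := N (c + m) - N c.
  have -> : (N (a + m)).+1 = (N a).+1 + n1 by lia.
  have -> : (N (c + m)).+1 = (N c).+1 + n2 by lia.
  have [le21 | lt12] := leqP n2 n1.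
    have le2n : n2 <= n by lia.
    have [b1 b2] := balN _ le2n (N c).+1 (N a).+1 isT.
    have := N_range ((N a).+1 + n2) (n1 - n2).
    have -> : (N a).+1 + n2 + (n1 - n2) = (N a).+1 + n1 by lia.
    have [lt2 | ge2] := ltnP n1 n2.+2; first by lia.
    have e : n1 = n2.+2 by lia.
    by rewrite e; lia.
  have le1n : n1 <= n by lia.
  have [b1 _] := balN _ le1n (N c).+1 (N a).+1 isT.
  have := N_range ((N c).+1 + n1) (n2 - n1).
  have -> : (N c).+1 + n1 + (n2 - n1) = (N c).+1 + n2 by lia.
  by lia.
(* For a = 0 the first step of both windows is set apart: [B 1 = 0] follows from [N 1 = 0], and [B]
   is monotone at the end of the other window. *)
case=> [|a] c c_gt0; last exact: pos.
case: n pos {balN} => [|n] pos; first by rewrite !addn0; lia.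
have := pos 1 c n (leqnSn n) isT c_gt0.
have N1 : N 1 = 0 by have := N_lb 1 isT; have := p_gt1; nia.
have := B_mono (c + n) 1; have := B_rec 1.
by rewrite N1 N1 (add0n n.+1) (add1n n) (addn1 (c + n)) (addnS c); lia.
Qed.

Lemma B_balance n : B_balanced n.
Proof.
elim/ltn_ind: n => n IHn; apply: B_balanced_step => m le_mn.
by apply: N_balanced_step => k lt_km; apply: IHn; apply: leq_trans le_mn.
Qed.

End CountingRecursion.

(** * The fixed point as a sequence of blocks *)

Section FixedPoint.

Variable p : nat.
Hypothesis p_gt1 : 1 < p.

Lemma phi_cat s t : phi p (s ++ t) = phi p s ++ phi p t.
Proof. by rewrite /phi map_cat flatten_cat. Qed.

Lemma size_phi s : size s <= size (phi p s).
Proof.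
elim: s => //= a s IHs; rewrite -cat1s phi_cat size_cat -add1n leq_add //.
by case: a => //; rewrite /phi /= cats0 size_rcons.
Qed.

Lemma phi_iterS n : phi_iter p n.+1 = phi p (phi_iter p n).
Proof. by []. Qed.

Lemma phi_iter_prefix m n : prefix (phi_iter p m) (phi_iter p (m + n)).
Proof.
elim: n => [|n IHn]; first by rewrite addn0 prefix_refl.
rewrite addnS; apply: prefix_trans IHn _; elim: (m + n) => {m n} [|n].
  by case: p p_gt1 => // q _; rewrite /phi_iter /phi /= cats0 /= prefix0s.
by case/prefixP=> s e; rewrite [phi_iter p n.+2]phi_iterS {2}e phi_cat; apply: prefix_prefix.
Qed.

Lemma size_phi_iter n : n < size (phi_iter p n).
Proof.
elim: n => // n IHn; have /prefixP[s e] := phi_iter_prefix 0 n.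
rewrite add0n in e; rewrite e size_cat /= add1n in IHn.
rewrite phi_iterS e phi_cat size_cat.
have -> : size (phi p [:: lL]) = p.+1 by rewrite /phi /= cats0 size_rcons size_nseq.
by have := size_phi s; lia.
Qed.

Definition pre k := mkseq (u p) k.

Lemma pre_take n k : k <= size (phi_iter p n) -> pre k = take k (phi_iter p n).
Proof.
move=> le_k; apply: (@eq_from_nth _ lL) => [|i].
  by rewrite size_mkseq size_takel.
rewrite size_mkseq => lt_ik; rewrite nth_mkseq // nth_take // /u.
have lt_i := leq_trans lt_ik le_k; have lt_i1 := ltnW (size_phi_iter i.+1).
have [le_n | /ltnW le_n] := leqP i.+1 n.
  have /prefixP[s e] := phi_iter_prefix i.+1 (n - i.+1).
  by rewrite subnKC // in e; rewrite e nth_cat lt_i1.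
have /prefixP[s e] := phi_iter_prefix n (i.+1 - n).
by rewrite subnKC // in e; rewrite e nth_cat lt_i.
Qed.

(** The position in u where the image of its letter [u p k] starts. *)
Definition blk k := size (phi p (pre k)).

Lemma pre_blk k r : r <= size (phi_letter p (u p k)) ->
  pre (blk k + r) = phi p (pre k) ++ take r (phi_letter p (u p k)).
Proof.
move=> le_r; have lt_k := size_phi_iter k.
have e : phi_iter p k.+1 = phi p (pre k) ++
    (phi_letter p (u p k) ++ phi p (drop k.+1 (phi_iter p k))).
  rewrite phi_iterS -[phi_iter p k in LHS](cat_take_drop k) phi_cat.
  rewrite -(pre_take _ _ (ltnW lt_k)).
  rewrite (drop_nth lL) // -cat1s phi_cat /phi /= cats0.
  congr (_ ++ (phi_letter p _ ++ _)).
  have := congr1 (fun s => nth lL s k) (pre_take _ _ lt_k).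
  by rewrite nth_mkseq // nth_take.
rewrite (@pre_take k.+1); last by rewrite e !size_cat leq_add2l (leq_trans le_r) ?leq_addr.
by rewrite e takeD take_size_cat // drop_size_cat // takel_cat.
Qed.

(** * Counts of S and M in prefixes *)

Lemma occ_phi s :
  [/\ occ lS (phi p s) + occ lS s = size s, occ lM (phi p s) = occ lS s
    & size (phi p s) + p * occ lS s + occ lM s = p.+1 * size s].
Proof.
elim: s => [|a s [IH1 IH2 IH3]]; first by rewrite /phi /= !muln0.
rewrite -cat1s phi_cat /occ !(count_cat, size_cat) -![count_mem _ _]/(occ _ _).
rewrite !mulnDr; case: a; rewrite /phi /occ /= ?cats0;
  rewrite -?cats1 ?count_cat ?size_cat ?size_nseq ?count_nseq /=;
  rewrite -![count_mem _ _]/(occ _ _) -/(phi p s); have := p_gt1; split; lia.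
Qed.

Definition nS k := occ lS (pre k).
Definition nM k := occ lM (pre k).

Lemma pre_cat i n : pre (i + n) = pre i ++ factor_at p i n.
Proof.
by rewrite /pre /mkseq iotaD map_cat /factor_at /mkseq add0n -[i in iota i n]addn0 iotaDl -map_comp.
Qed.

Lemma nS_succ k : nS k.+1 = nS k + (u p k == lS).
Proof. by rewrite /nS -addn1 pre_cat /occ count_cat /= !addn0. Qed.

Lemma nS_mono k n : nS k <= nS (k + n) <= nS k + n.
Proof.
by elim: n => [|n IHn]; rewrite ?addn0 ?addnS ?nS_succ; lia.
Qed.

Lemma blk_eq k : blk k + p * nS k + nM k = p.+1 * k.
Proof. by have [_ _] := occ_phi (pre k); rewrite size_mkseq. Qed.

Lemma blk_succ k : blk k.+1 = blk k + size (phi_letter p (u p k)).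
Proof.
by rewrite /blk -addn1 pre_cat phi_cat size_cat /phi /= cats0 addn0.
Qed.

Lemma blk_mono j n : blk j + n <= blk (j + n).
Proof.
elim: n => [|n IHn]; rewrite ?addn0 // !addnS blk_succ.
apply: (@leq_trans (blk (j + n)).+1) => //; rewrite -addn1 leq_add2l.
by case: (u p _); rewrite ?size_rcons.
Qed.

(** A proper prefix of a block has no letter but L, so every S and M counted lies in one of the
    first [k] blocks. *)
Lemma in_blk k r : r < size (phi_letter p (u p k)) ->
  nS (blk k + r) + nS k = k /\ nM (blk k + r) = nS k.
Proof.
move=> lt_r; have [hS hM _] := occ_phi (pre k).
rewrite size_mkseq -/(nS k) in hS hM.
rewrite {1}/nS /nM (pre_blk _ _ (ltnW lt_r)) /occ !count_cat.
rewrite -![count _ (phi _ _)]/(occ _ _) hM.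
suff [-> ->] : count_mem lS (take r (phi_letter p (u p k))) = 0 /\
               count_mem lM (take r (phi_letter p (u p k))) = 0.
  by rewrite !addn0 hS.
case: (u p k) lt_r => /=; rewrite ?size_rcons ?size_nseq ltnS.
- by move=> le_r; rewrite -cats1 takel_cat ?size_nseq // take_nseq // !count_nseq.
- by rewrite leqn0 => /eqP->.
- by move=> le_r; rewrite -cats1 takel_cat ?size_nseq // take_nseq // !count_nseq.
Qed.

Lemma blkP i : exists k r, i = blk k + r /\ r < size (phi_letter p (u p k)).
Proof.
have pos k : 0 < size (phi_letter p (u p k)) by case: (u p k); rewrite ?size_rcons.
elim: i => [|i [k [r [-> lt_r]]]]; first by exists 0, 0.
have [lt_r1 | ge_r1] := ltnP r.+1 (size (phi_letter p (u p k))).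
  by exists k, r.+1; rewrite addnS.
by exists k.+1, 0; rewrite blk_succ; split=> //; lia.
Qed.

(** An S closes its block, and every block starts with L or M because p > 1. *)
Lemma nS_succ2 i : nS i.+2 <= (nS i).+1.
Proof.
have [k [r [-> lt_r]]] := blkP i; have [h1 _] := in_blk _ _ lt_r.
have [lt_r1 | ge_r1] := ltnP r.+1 (size (phi_letter p (u p k))).
  have := in_blk _ _ lt_r1; rewrite addnS => -[h2 _].
  by have := nS_succ (blk k + r).+1; lia.
have e : (blk k + r).+2 = blk k.+1 + 1 by rewrite blk_succ; lia.
have := nS_succ k; have [lt1 | le1] := ltnP 1 (size (phi_letter p (u p k.+1))).
  by have [] := in_blk _ _ lt1; rewrite e; lia.
have uS : u p k.+1 = lS.
  by case: (u p _) le1; rewrite ?size_rcons ?size_nseq //=; have := p_gt1; lia.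
have e2 : (blk k + r).+2 = blk k.+2 + 0.
  by rewrite e (blk_succ k.+1) uS addn0.
have [|h3 _] := in_blk k.+2 0; first by case: (u p _); rewrite ?size_rcons.
by have := nS_succ k.+1; rewrite uS eqxx e2; lia.
Qed.

Lemma nS_add k n : nS (k + n.+2) <= nS k + n.+1.
Proof.
have := nS_succ2 k; have /andP[_] := nS_mono k.+2 n.
by rewrite !addnS !addSn; lia.
Qed.

Lemma nS_le_half k : 2 * nS k <= k.
Proof.
suff: 2 * nS k <= k /\ 2 * nS k.+1 <= k.+1 by case.
elim: k => [|k [h1 h2]]; last by have := nS_succ2 k; lia.
by rewrite nS_succ /u /phi_iter /phi /=; case: p p_gt1.
Qed.

(** * Prefixes indexed by their letters other than S *)

(** This is e(j) of the header; a single test for S suffices because no two S are adjacent. *)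
Fixpoint nonS_pos j :=
  if j is i.+1 then (nonS_pos i + (u p (nonS_pos i) == lS)).+1 else 0.

(* [nS_at] and [nSL_at] are the functions [N] and [B] of the header; as every [lM]
   follows an [lS] and no [lS] follows an [lS], [nSL_at j] counts the
   occurrences of [lS lL] in the prefix. *)
Definition nS_at j := nS (nonS_pos j).
Definition nSL_at j := nS_at j - nM (nonS_pos j).

Lemma nonS_pos_eq j : nonS_pos j = j + nS_at j.
Proof.
elim: j => // j IHj; rewrite /nS_at /=.
have := nS_succ2 (nonS_pos j); have := nS_succ (nonS_pos j).
have := nS_succ (nonS_pos j).+1; rewrite /nS_at in IHj.
by case: (u p (nonS_pos j) == _) => /=; rewrite ?addn0 ?addn1; lia.
Qed.

Lemma nS_at_pred j : 0 < j -> nS (nonS_pos j).-1 = nS_at j.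
Proof.
case: j => // j _; rewrite /nS_at /=.
have := nS_succ2 (nonS_pos j); have := nS_succ (nonS_pos j).
have := nS_succ (nonS_pos j).+1.
by case: (u p (nonS_pos j) == _) => /=; rewrite ?addn0 ?addn1 /=; lia.
Qed.

Lemma nS_at_step j : nS_at j <= nS_at j.+1 <= (nS_at j).+1.
Proof.
have := nonS_pos_eq j; have := nonS_pos_eq j.+1; rewrite [nonS_pos j.+1]/=.
by case: (_ == _); lia.
Qed.

Lemma leq_nonS_pos j k : (nonS_pos j <= k) = (j + nS k <= k).
Proof.
have [le_k | lt_k] := leqP (nonS_pos j) k.
  have := nS_mono (nonS_pos j) (k - nonS_pos j); rewrite subnKC //.
  by have := nonS_pos_eq j; rewrite /nS_at; lia.
case: j lt_k => // j lt_k; have := nS_at_pred j.+1 isT.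
have := nS_mono k ((nonS_pos j.+1).-1 - k); rewrite subnKC; last by lia.
by have := nonS_pos_eq j.+1; lia.
Qed.

Lemma leq_nS j i : (j <= nS i) = (blk (nonS_pos j) <= i).
Proof.
have [k [r [-> lt_r]]] := blkP i; have [h _] := in_blk _ _ lt_r.
have -> : (j <= nS (blk k + r)) = (nonS_pos j <= k) by rewrite leq_nonS_pos; lia.
have [le_k | lt_k] := leqP (nonS_pos j) k.
  have := blk_mono (nonS_pos j) (k - nonS_pos j); rewrite subnKC //.
  by lia.
have := blk_mono k.+1 (nonS_pos j - k.+1); rewrite subnKC // blk_succ.
by lia.
Qed.

(** This makes the truncated subtraction in [nSL_at] exact. *)
Lemma nM_le_nS i : nM i <= nS i.
Proof.
have [k [r [-> lt_r]]] := blkP i; have [h1 ->] := in_blk _ _ lt_r.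
by have := nS_le_half k; lia.
Qed.

Lemma blk_nonS_pos j : blk (nonS_pos j) = p.+1 * j + nSL_at j.
Proof.
have := blk_eq (nonS_pos j); have := nM_le_nS (nonS_pos j).
have : p * nonS_pos j = p * j + p * nS_at j by rewrite {1}nonS_pos_eq mulnDr.
by have := nonS_pos_eq j; rewrite /nSL_at /nS_at; lia.
Qed.

Lemma nS_bounds i :
  p.+1 * nS i + nSL_at (nS i) <= i < p.+1 * (nS i).+1 + nSL_at (nS i).+1.
Proof. by rewrite -!blk_nonS_pos -leq_nS leqnn ltnNge -leq_nS ltnn. Qed.

Lemma nSL_at_rec j : nSL_at j + nS_at (nS_at j).+1 = nS_at j.
Proof.
rewrite /nSL_at; have leM := nM_le_nS (nonS_pos j).
suff <- : nM (nonS_pos j) = nS_at (nS_at j).+1 by rewrite subnK.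
have [k [r [e lt_r]]] := blkP (nonS_pos j); have [] := in_blk _ _ lt_r.
rewrite -e -/(nS_at j) => hS ->; set t := nS_at j in hS *.
have lt_k : k < nonS_pos t.+1 by rewrite ltnNge leq_nonS_pos; lia.
have le_k : nonS_pos t <= k by rewrite leq_nonS_pos; lia.
have eq1 := nonS_pos_eq t.+1; have pred1 := nS_at_pred t.+1 isT.
set q := (nonS_pos t.+1).-1 in pred1.
(* All letters from position [nonS_pos t] up to [q], excluded, are S, so there is at most one; only
   [k = nonS_pos t] with [u p k = lS] could differ from [q]. *)
have [-> // | lt_kq] := eqVneq k q.
have [lt2 | le2] := ltnP k.+1 q.
  have := nS_add k (q - k.+2); have -> : k + (q - k.+2).+2 = q by lia.
  by rewrite pred1; lia.
have qE : q = k.+1 by lia.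
have uS : u p k = lS.
  by apply/eqP; have := nS_succ k; rewrite -qE pred1; case: (_ == _) => //=; lia.
have r0 : r = 0 by move: lt_r; rewrite uS /=; lia.
have [k_eq | k_ne] := eqVneq (nonS_pos t) k.
  have [j0 | j_gt0] := posnP j.
    have k0 : k = 0 by have := blk_mono 0 k; rewrite j0 add0n in e *; move: e => /=; lia.
    by have := nS_le_half 1; have := nS_succ 0; rewrite -[in u p 0]k0 uS eqxx; lia.
  have pos_gt0 : 0 < nonS_pos j by have := nonS_pos_eq j; lia.
  (* Here [nonS_pos j = blk (nonS_pos t)] is the least length with [t] letters S, yet the prefix one
     shorter already has [t]. *)
  have := leq_nS t (nonS_pos j).-1; rewrite nS_at_pred // leqnn k_eq; lia.
have := nS_add (nonS_pos t) (k.+1 - (nonS_pos t).+2).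
have -> : nonS_pos t + (k.+1 - (nonS_pos t).+2).+2 = k.+1 by lia.
by have := nonS_pos_eq t; rewrite /nS_at -qE pred1; lia.
Qed.

(** The shortest prefix does not end with S, so [nS_bounds] applies one position earlier with the
    same count; hence the strict inequality. *)
Lemma nS_at_lb j : 0 < j -> p * nS_at j + nSL_at (nS_at j) < j.
Proof.
move=> j_gt0; have := nS_bounds (nonS_pos j).-1.
by rewrite nS_at_pred //; have := nonS_pos_eq j; lia.
Qed.

Lemma nS_at_ub j : j <= p * (nS_at j).+1 + nSL_at (nS_at j).+1.
Proof.
have := nS_bounds (nonS_pos j); rewrite -/(nS_at j).
by have := nonS_pos_eq j; rewrite !mulnS; lia.
Qed.

(** * Balance of the factors of u *)

Lemma occ_factor i n : nS i + occ lS (factor_at p i n) = nS (i + n).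
Proof. by rewrite /nS pre_cat /occ count_cat. Qed.

Lemma occ_factor_balanced i j n :
  occ lS (factor_at p i n) <= occ lS (factor_at p j n) + 2.
Proof.
have si := occ_factor i n; have sj := occ_factor j n; rewrite leqNgt; apply/negP.
set k := occ lS (factor_at p j n) in sj *; move=> lt_k.
(* By [nS_bounds], the increment of [nSL_at] over [k.+1] steps from [nS j] would exceed the one from
   [(nS i).+1] by at least p + 3. *)
have := B_balance _ _ nS_at_step nSL_at_rec _ p_gt1 nS_at_lb nS_at_ub
  k.+1 (nS j) (nS i).+1 isT.
have := B_mono _ _ nS_at_step nSL_at_rec ((nS i).+1 + k.+1) (nS (i + n) - nS i - k.+2).
have -> : (nS i).+1 + k.+1 + (nS (i + n) - nS i - k.+2) = nS (i + n) by lia.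
have -> : nS j + k.+1 = (nS (j + n)).+1 by lia.
have := nS_bounds i; have := nS_bounds j.
have := nS_bounds (i + n); have := nS_bounds (j + n).
have : p.+1 * nS (i + n) = p.+1 * (nS i + k + 3 + (nS (i + n) - nS i - k - 3)).
  by congr (p.+1 * _); lia.
have : p.+1 * (nS (j + n)).+1 = p.+1 * (nS j + k).+1 by congr (p.+1 * _); lia.
rewrite !mulnS !mulnDr.
move: (p.+1 * k) (p.+1 * nS i) (p.+1 * nS j) (p.+1 * (_ - _)) (p.+1 * nS (i + n)).
by have := p_gt1; lia.
Qed.

End FixedPoint.

Theorem theorem5p1 (p : nat) (v w : seq letter) :
  1 < p -> is_factor p v -> is_factor p w -> size v = size w ->
  (`|(occ lS v)%:Z - (occ lS w)%:Z| <= 2)%R.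
Proof.
move=> p_gt1 [i ->] [j ->]; rewrite !size_mkseq => <-.
have := occ_factor_balanced p p_gt1 i j (size v).
by have := occ_factor_balanced p p_gt1 j i (size v); lia.
Qed.
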